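(* Let $p$ be a prime, $r\ge 1$ an integer and $a$ a complex number, and put $q=p^a$. For non-negative integers $f_1,\dots,f_r$ let $[p;f_1,\dots,f_r]$ denote the finite abelian group $$\mathbb{Z}/p^{f_1}\mathbb{Z}\times\mathbb{Z}/p^{f_1+f_2}\mathbb{Z}\times\cdots\times\mathbb{Z}/p^{f_1+f_2+\cdots+f_r}\mathbb{Z},$$ and for a finite abelian group $F$ let $\sigma_a(F)=\sum_{H\le F}|H|^a$, the sum being over all subgroups $H$ of $F$. For $\epsilon\in\{-1,1\}$ write $\epsilon^*=(1-\epsilon)/2$. Then, as formal power series in $X_1,\dots,X_r$ (each factor $\frac{1}{1-cX_t}$ being expanded as $\sum_{n\ge0}c^nX_t^n$), $$\sum_{f_1,\dots,f_r\ge0}\sigma_a([p;f_1,\dots,f_r])\,X_1^{f_1}\cdots X_r^{f_r} =\sum_{(\epsilon_k)\in\{-1,1\}^r}\prod_{t=1}^{r}\frac{-\epsilon_t\,p^{\epsilon_t^*\left(a+\sum_{h=t+1}^r\epsilon_h\right)}}{p^{a+\sum_{h=t+1}^r\epsilon_h}-1}\cdot\frac{1}{1-p^{(a+r-t+1)\sum_{h=t}^r\epsilon_h^*-\left(\sum_{h=t}^r\epsilon_h^*\right)^2}X_t}.$$ In particular this series belongs to $\mathbb{Q}(p,p^a,X_1,\dots,X_r)$, and its product with $$B_r(p,q,X_1,\dots,X_r)=\prod_{t=1}^r\prod_{j=0}^{r-t+1}\bigl(1-q^jp^{(r-t+1)j-j^2}X_t\bigr)$$ lies in $\mathbb{Q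}[p,p^a,X_1,\dots,X_r]$.
   Context: Empty sums are $0$ (e.g. $\sum_{h=r+1}^r\epsilon_h=0$).
   Formalization: The closed formula is asserted only for those a for which every denominator p^{a+ε_{t+1}+…+ε_r} − 1 is nonzero (for a = 0, for instance, the right-hand side is undefined); the two rationality claims are proved for every complex a. *)

(* Defs.v *)
From HB Require Import structures.
From mathcomp Require Import all_boot all_order all_algebra all_fingroup.
From mathcomp Require Import complex mpoly.
From mathcomp Require Import reals.
From mathcomp Require sequences exp trigo.

Set Implicit Arguments.
Unset Strict Implicit.
Unset Printing Implicit Defensive.

Import GRing.Theory Num.Theory.
Local Open Scope ring_scope.
Local Open Scope complex_scope.

Definition cexp (R : realType) (z : R[i]) : R[i] :=
  let: x +i* y := z in
  (sequences.expR x * trigo.cos y) +i* (sequences.expR x * trigo.sin y).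

(* The principal value [exp (z log n)]; only meaningful for [0 < n]. *)
Definition cpow (R : realType) (n : nat) (z : R[i]) : R[i] :=
  cexp (z * (exp.ln (n%:R : R))%:C).

(* With 0-based indices, [pexpo f i] is the exponent [f_1 + ... + f_(i+1)]. *)
Definition pexpo (r : nat) (f : 'X_{1..r}) (i : 'I_r) : nat :=
  (\sum_(j < r | (j <= i)%N) f j)%N.

(* [Zp n] is all of ['Z_n] for [1 < n] and the trivial group for [n = 1],
   whereas the type ['Z_1] has two elements. *)
Definition pgrp (p r : nat) (f : 'X_{1..r}) :
    {group {dffun forall i : 'I_r, 'Z_(p ^ pexpo f i)}} :=
  [group of setXn (fun i : 'I_r => Zp (p ^ pexpo f i))].

Definition sigma (R : realType) (a : R[i]) (gT : finGroupType)
    (F : {group gT}) : R[i] :=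
  \sum_(H : {group gT} | H \subset F) cpow #|H| a.

(* A formal power series in ['X_0, ..., 'X_(r-1)] is its family of
   coefficients; equality of series is [=1]. *)
Definition fps (K : Type) (r : nat) := 'X_{1..r} -> K.

Section FormalPowerSeries.
Variables (K : comNzRingType) (r : nat).
Implicit Types (A B : fps K r) (P : {mpoly K[r]}).

Definition fps_of_mpoly P : fps K r := fun m => P@_m.

(* The Cauchy product; both indices of a decomposition [m = k1 + k2] have
   degree at most [mdeg m]. *)
Definition fps_mul A B : fps K r := fun m =>
  \sum_(k : 'X_{1..r < (mdeg m).+1, (mdeg m).+1}
        | m == (bmnm k.1 + bmnm k.2)%MM)
    A (bmnm k.1) * B (bmnm k.2).

Definition fps_scale (c : K) A : fps K r := fun m => c * A m.

Definition fps_one : fps K r := fps_of_mpoly 1.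

(* The expansion [\sum_n c ^+ n * 'X_t ^+ n] of [1 / (1 - c 'X_t)]. *)
Definition fps_geom (c : K) (t : 'I_r) : fps K r := fun m =>
  if m == (U_(t) *+ m t)%MM then c ^+ m t else 0.

End FormalPowerSeries.

Definition sigma_series (R : realType) (p r : nat) (a : R[i]) : fps R[i] r :=
  fun f => sigma a (pgrp p f).
Arguments sigma_series {R} p r a f.

(* [{-1, 1}] is encoded by [bool], with [true] standing for [-1]. *)
Definition sgn (R : realType) (b : bool) : R[i] := (-1) ^+ b.

Definition star (R : realType) (e : R[i]) : R[i] := (1 - e) / 2.

Section RightHandSide.
Variables (R : realType) (p r : nat) (a : R[i]) (eps : {ffun 'I_r -> bool}).

(* The index [t : 'I_r] stands for the 1-based index [t + 1]; in particular
   the 1-based [r - t + 1] becomes [r - t]. *)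
Definition tail_exponent (t : 'I_r) : R[i] :=
  a + \sum_(h < r | (t < h)%N) sgn R (eps h).

Definition tail_star (t : 'I_r) : R[i] :=
  \sum_(h < r | (t <= h)%N) star (sgn R (eps h)).

Definition rhs_coef (t : 'I_r) : R[i] :=
  - sgn R (eps t) * cpow p (star (sgn R (eps t)) * tail_exponent t)
  / (cpow p (tail_exponent t) - 1).

Definition rhs_pole (t : 'I_r) : R[i] :=
  cpow p ((a + (r - t)%:R) * tail_star t - tail_star t ^+ 2).

Definition rhs_term : fps R[i] r :=
  \big[@fps_mul R[i] r/@fps_one R[i] r]_(t < r)
    fps_scale (rhs_coef t) (fps_geom (rhs_pole t) t).

End RightHandSide.

Definition rhs_series (R : realType) (p r : nat) (a : R[i]) : fps R[i] r :=
  fun m => \sum_(eps : {ffun 'I_r -> bool}) rhs_term p a eps m.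
Arguments rhs_series {R} p r a m.

(* No subtraction below truncates, since [j <= r - t]. *)
Definition Bpoly (R : realType) (p r : nat) (q : R[i]) : {mpoly R[i][r]} :=
  \prod_(t < r) \prod_(j < (r - t).+1)
    (1 - (q ^+ j * p%:R ^+ ((r - t) * j - j ^ 2)) *: 'X_t).
Arguments Bpoly {R} p r q.

Section Rationality.
Variables (R : realType) (r : nat) (x y : R[i]).

(* The image of [P] in [R[i]['X_0, ..., 'X_(r-1)]] when its first two
   variables are specialized to [x] and [y]. *)
Definition spec (P : {mpoly rat[2 + r]}) : {mpoly R[i][r]} :=
  mmap (fun c : rat => (ratr c)%:MP)
    (fun i : 'I_(2 + r) =>
       match split i with
       | inl j => (if j == ord0 then x else y)%:MP
       | inr k => 'X_k
       end) P.

Definition in_Qpoly (S : fps R[i] r) : Prop :=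
  exists P : {mpoly rat[2 + r]}, S =1 fps_of_mpoly (spec P).

Definition in_Qratfun (S : fps R[i] r) : Prop :=
  exists N D : {mpoly rat[2 + r]},
    spec D != 0 /\
    fps_mul S (fps_of_mpoly (spec D)) =1 fps_of_mpoly (spec N).

End Rationality.

(* Main.v *)
(** Let [F = D x <z>] be an abelian p-group with [z] of order [p^n] and
    [D ^ (p^n) = 1], and put [q = p^a].  A subgroup [H] of [F] is determined by
    [K = H n D], the integer [j] with [|H| = |K| p^j], and a class modulo [K] of
    elements [x] of [D] with [x^(p^j)] in [K], namely those for which
    [z^(p^(n-j)) x] lies in [H].  Summing the geometric series in [q] over [j]
    gives
      [(q - 1) sigma_a(F) = q^(n+1) |D| sigma_(a-1)(D) - T],
    where [T] is the sum over [K <= D] and [x] in [D] of [|<K, x>|^a / |K|].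
    Grouping the pairs [(K, x)] by [L = <K, x>] reduces [T] to the identity
      [sum over K <= L of the number of generators of L / K = |L|],
    which counts the irreducible characters of [L] by their kernels; hence
    [T = sigma_(a+1)(D)].  The right-hand side of the theorem satisfies the same
    recursion when the last sign is split off.

    For the rationality claims, the coefficients of the product with [B_r] are
    polynomials in [q] over the rationals.  Those of large multidegree vanish
      for
    every integer [q > p^r], where the explicit formula applies and each pole
    cancels against a factor of [B_r]; so they vanish identically. *)

Require Import Defs.
From HB Require Import structures.
From mathcomp Require Import all_boot all_order all_algebra all_fingroup.
From mathcomp Require Import all_solvable all_character.
From mathcomp Require Import complex mpoly.
From mathcomp Require Import reals ring.
From mathcomp Require sequences exp trigo.

Set Implicit Arguments.
Unset Strict Implicit.
Unset Printing Implicit Defensive.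

Import Order.TTheory GRing.Theory Num.Theory.

(** * Counting the characters of a finite abelian group by their kernels *)

Section CyclicQuotients.
Local Open Scope ring_scope.
Local Open Scope group_scope.

(** Inflation along [G -> G / K] matches the faithful irreducible characters of the quotient with
    those of kernel exactly [K]; [mod_Iirr] and [quo_Iirr] are the two directions. *)
Lemma card_irr_cfker (gT : finGroupType) (G K : {group gT}) : K <| G ->
  #|[set i : Iirr G | cfker 'chi_i == K]|
  = #|[set i : Iirr (G / K) | cfaithful 'chi_i]|.
Proof.
move=> nKG; rewrite -!sum1_card.
rewrite (reindex_onto (@mod_Iirr _ G K) (@quo_Iirr _ G K)) /=; last first.
  by move=> i; rewrite inE => /eqP kerK; rewrite quo_IirrK // kerK.
apply: eq_bigl => j; rewrite !inE mod_IirrK // eqxx andbT mod_IirrE //.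
rewrite cfaithfulE eqEsubset cfker_mod // andbT.
rewrite -[in RHS](quotient_cfker_mod set0 'chi_j nKG) quotient_sub1 //.
by rewrite (subset_trans (cfker_sub _)) ?normal_norm.
Qed.

Lemma sum_card_irr_cfker (gT : finGroupType) (G : {group gT}) :
  (\sum_(K : {group gT} | K \subset G)
     #|[set i : Iirr G | cfker 'chi_i == K]|)%N = #|Iirr G|.
Proof.
rewrite -[RHS]sum1_card.
rewrite [RHS](partition_big (fun i => cfker_group 'chi[G]_i)
                (fun K : {group gT} => K \subset G)) /=; last first.
  by move=> i _; apply: cfker_sub.
by apply: eq_bigr => K _; rewrite -sum1_card; apply: eq_bigl => i;
  rewrite inE -val_eqE.
Qed.

(** In a cyclic group the index is a bijection from subgroups to divisors of the order, so this is
    the divisor sum of [totient]. *)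
Lemma sum_totient_indexg (gT : finGroupType) (G : {group gT}) : cyclic G ->
  (\sum_(K : {group gT} | K \subset G) totient #|G : K|)%N = #|G|.
Proof.
move=> cG; rewrite -[RHS]sum_totient_dvd.
rewrite (reindex_onto (fun K : {group gT} => inord #|G : K| : 'I_(#|G|.+1))
   (fun d : 'I__ => odflt 1%G
      [pick K : {group gT} | (K \subset G) && (#|G : K| == d)])) /=.
  apply: eq_big => [K|K sKG]; last first.
    by rewrite inordK // ltnS dvdn_leq // dvdn_indexg.
  (* Both the picked group and the default [1%G] lie in [G], so the round trip never returns a [K]
     outside [G]. *)
  have [sKG|sKG] := boolP (K \subset G); last first.
    apply/esym/negbTE; rewrite negb_and orbC;
      case: pickP => [L /andP[sLG _]|_] /=.
      by rewrite (contraNneq _ sKG) // => <-.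
    by rewrite (contraNneq _ sKG) // => <-; apply: sub1G.
  rewrite inordK ?ltnS ?(dvdn_leq _ (dvdn_indexg _ _)) // dvdn_indexg /=.
  case: pickP => [L /andP[sLG /eqP iL]|/(_ K)] /=; last by rewrite sKG eqxx.
  apply/esym/eqP/group_inj/eqP; rewrite (eq_subG_cyclic cG) //.
  by rewrite -(divg_indexS sLG) iL divg_indexS.
move=> d d_dv /=; case: pickP => [K /andP[_ /eqP iK]|] /=.
  by apply: val_inj; rewrite /= iK inordK.
have [K sKG oK] : exists2 K : {group gT}, K \subset G & #|K| = (#|G| %/ d)%N.
  have /cyclicP[x Gx] := cG; exists <[x ^+ d]>%G.
    by have := cycleX x d; rewrite -Gx.
  by rewrite -orderE orderXdiv orderE -Gx.
have d_gt0 : (0 < d)%N by apply: dvdn_gt0 d_dv.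
have q_gt0 : (0 < #|G| %/ d)%N by rewrite divn_gt0 // dvdn_leq.
move/(_ K); rewrite sKG -divgS // oK.
by rewrite (_ : (#|G| %/ (#|G| %/ d))%N = d) ?eqxx // -{1}(divnK d_dv) mulKn.
Qed.

Lemma card_generators (gT : finGroupType) (G : {group gT}) :
  cyclic G -> #|[set x | generator G x]| = totient #|G|.
Proof. by case/cyclicP=> x ->; rewrite -totient_gen. Qed.

(** Both counts are zero unless [G] is cyclic, a faithful irreducible character forcing a cyclic
    centre. For cyclic [G], characters sorted by kernel and totients of indices both add up to
    [#|G|]; the terms with [K != 1] agree by induction on [G / K], hence so do those with
    [K = 1]. *)
Lemma card_cfaithful_irr (gT : finGroupType) (G : {group gT}) : abelian G ->
  #|[set i : Iirr G | cfaithful 'chi_i]| = #|[set x | generator G x]|.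
Proof.
have [n] := ubnP #|G|; elim: n gT G => // n IHn gT G /ltnSE leGn abG.
have [cG|ncG] := boolP (cyclic G); last first.
  rewrite !eq_card0 // => x; rewrite !inE; apply: contraNF ncG.
    by rewrite /generator => /eqP->; apply: cycle_cyclic.
  by move/irr_faithful_center; rewrite (center_idP _).
have := card_Iirr_abelian abG; rewrite -sum_card_irr_cfker.
rewrite -(sum_totient_indexg cG) (bigD1 1%G) ?sub1G //=.
rewrite [in RHS](bigD1 1%G) ?sub1G //= indexg1 card_generators //.
rewrite [in X in _ = (_ + X)%N -> _](eq_bigr (fun K : {group gT} =>
  #|[set i : Iirr G | cfker 'chi_i == K]|)).
  move/addIn => <-; apply: eq_card => i; rewrite !inE cfaithfulE.
  by rewrite eqEsubset sub1G andbT.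
move=> K /andP[sKG ntK].
have nKG : K <| G by rewrite -sub_abelian_normal.
rewrite card_irr_cfker // IHn ?quotient_abelian //.
  by rewrite card_generators ?quotient_cyclic // card_quotient ?normal_norm.
by apply: leq_trans leGn; rewrite ltn_quotient.
Qed.

(* Dual to [\sum_(C cyclic) totient #|C| = #|L|]: each irreducible character
   of [L] is recorded by its kernel, whose quotient is cyclic. *)
Lemma sum_quotient_generators (gT : finGroupType) (L : {group gT}) :
  abelian L ->
  (\sum_(K : {group gT} | K \subset L) #|[set y | generator (L / K) y]|)%N
  = #|L|.
Proof.
move=> abL; rewrite -(card_Iirr_abelian abL) -sum_card_irr_cfker.
apply: eq_bigr => K sKL; have nKL : K <| L by rewrite -sub_abelian_normal.
by rewrite -card_cfaithful_irr ?quotient_abelian // -card_irr_cfker.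
Qed.

End CyclicQuotients.

(** * Subgroups of a direct product with a cyclic factor *)

Section CyclicFactor.
Local Open Scope group_scope.
Variables (gT : finGroupType) (D F : {group gT}) (z : gT) (p n : nat).
Hypothesis p_prime : prime p.
Hypothesis defF : D \x <[z]> = F.
Hypothesis abF : abelian F.
Hypothesis oz : #[z] = (p ^ n)%N.

Let sDF : D \subset F.
Proof. by case/dprodP: defF => _ <- _ _; apply: mulG_subl. Qed.
Let zF : z \in F.
Proof.
by apply: subsetP (cycle_id z); case/dprodP: defF => _ <- _ _; apply: mulG_subr.
Qed.
Let DZ : D * <[z]> = F. Proof. by case/dprodP: defF. Qed.
Let tiDZ : D :&: <[z]> = 1. Proof. by case/dprodP: defF. Qed.

Let p_gt0 : (0 < p)%N := prime_gt0 p_prime.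

Let comF x y : x \in F -> y \in F -> commute x y.
Proof. by move=> xF yF; apply: (centsP abF). Qed.

Let zj j := z ^+ (p ^ (n - j)).

Let zjF j : zj j \in F. Proof. exact: groupX. Qed.

Let zj_order j : (j <= n)%N -> #[zj j] = (p ^ j)%N.
Proof.
move=> lejn; rewrite orderXdiv oz ?dvdn_exp2l ?leq_subr //.
by rewrite -expnB ?leq_subr ?subKn.
Qed.

Let zjX_in j i : (j <= n)%N -> (zj j ^+ i \in D) = (p ^ j %| i).
Proof.
move=> lejn; rewrite -(zj_order lejn) order_dvdn; apply/idP/eqP => [zD|->//].
by apply/set1gP; rewrite -tiDZ inE zD /zj -expgM mem_cycle.
Qed.

Let D_zj j : (j <= n)%N -> #|D * <[zj j]>| = (#|D| * p ^ j)%N.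
Proof.
move=> lejn; rewrite TI_cardMg -?orderE ?zj_order //.
by apply/trivgP; rewrite -tiDZ setIS // cycleX.
Qed.

(** * The subgroup generated by [K] and [zj j * x] *)

Section Extension.
Variables (K : {group gT}) (j : nat) (x : gT).
Hypotheses (sKD : K \subset D) (lejn : (j <= n)%N).
Hypotheses (xD : x \in D) (xK : x ^+ (p ^ j) \in K).

Let y := zj j * x.
Let yF : y \in F. Proof. by rewrite groupM ?zjF ?(subsetP sDF). Qed.
Let joinE : K <*> <[y]> = K * <[y]>.
Proof.
apply: cent_joinEr; rewrite (centSS _ _ abF) ?cycle_subG //.
by rewrite (subset_trans sKD).
Qed.

Lemma cyclic_ext_sub : K <*> <[y]> \subset F.
Proof. by rewrite join_subG (subset_trans sKD) //= cycle_subG. Qed.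

(** An element [k * y ^+ i] lies in [D] only if [p ^ j] divides [i]; then the [zj j] part vanishes
    and [y ^+ i] is a power of [x ^+ (p ^ j)], which is in [K]. *)
Lemma cyclic_extI : (K <*> <[y]>) :&: D = K.
Proof.
apply/eqP; rewrite eqEsubset subsetI joing_subl sKD !andbT joinE.
apply/subsetP => u /setIP[/mulsgP[k _ kK /cycleP[i ->] ->]].
rewrite (groupMl _ (subsetP sKD _ kK)) (groupMl _ kK).
rewrite expgMn; last by apply: comF; rewrite ?zjF ?(subsetP sDF).
rewrite (groupMr _ (groupX i xD)) zjX_in // => dvi.
rewrite -(divnK dvi) mulnC !expgM.
by rewrite -{1}(zj_order lejn) expg_order expg1n mul1g groupX.
Qed.

(** Since [y] and [zj j] differ by an element of [D], the extension and [<[zj j]>] have the same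
    product with [D]; the product formula for orders then applies. *)
Lemma card_cyclic_ext : #|K <*> <[y]>| = (#|K| * p ^ j)%N.
Proof.
have := mul_cardG (K <*> <[y]>)%G D; rewrite cyclic_extI /=.
have -> : (K <*> <[y]>) * D = D * <[zj j]>.
  have cKy : commute K <[y]>.
    by apply: centC; rewrite (centSS _ _ abF) ?cycle_subG // (subset_trans sKD).
  have cyD : commute <[y]> D by apply: centC;
    rewrite (centSS _ _ abF) ?cycle_subG.
  rewrite joinE -mulgA cyD mulgA (mulSGid sKD).
  have cc g : g \in F -> D * <[g]> = D <*> <[g]>.
    move=> gF; rewrite cent_joinEr //; rewrite (centSS _ _ abF) ?cycle_subG //.
  rewrite !cc //; apply/eqP;
    rewrite eqEsubset !join_subG !joing_subl !cycle_subG /=.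
  have jD (h : gT) : x \in D <*> <[h]> by apply: subsetP xD; apply: joing_subl.
  have jh (h : gT) : h \in D <*> <[h]> by rewrite -cycle_subG joing_subr.
  by rewrite groupM //= -(groupMr _ (jD y)) jh.
rewrite D_zj // mulnC -mulnA => /eqP; rewrite eqn_pmul2l ?cardG_gt0 //.
by rewrite (mulnC #|K|) => /eqP.
Qed.

End Extension.

(** The map sending [x] to the subgroup generated by [K] and [zj j * x] is onto the counted
    subgroups, and each of its fibres is a coset of [K]. *)
Lemma card_cyclic_ext_fibre (K : {group gT}) j : K \subset D -> (j <= n)%N ->
  (#|[set H : {group gT} |
        [&& H \subset F, H :&: D == K & #|H| == #|K| * p ^ j]]| * #|K|)%N
  = #|[set x in D | x ^+ (p ^ j) \in K]|.
Proof.
move=> sKD lejn; rewrite -sum_nat_const -[RHS]sum1_card.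
rewrite [RHS](partition_big (fun x => K <*> <[zj j * x]>)%G
  (fun H : {group gT} => H \in [set H : {group gT} |
     [&& H \subset F, H :&: D == K & #|H| == #|K| * p ^ j]%N])); last first.
  move=> x; rewrite !inE => /andP[xD xK].
  by rewrite cyclic_ext_sub ?cyclic_extI ?card_cyclic_ext ?eqxx.
apply: eq_bigr => H; rewrite inE => /and3P[sHF /eqP HD /eqP oH].
(* Surjectivity: [H * D] has order [#|D| * p ^ j], so it meets [<[z]>] in its subgroup of order
   [p ^ j], generated by [zj j]. Writing [zj j = h * d] gives [x0 = d^-1]. *)
have [x0 x0D yH] : exists2 x0, x0 \in D & zj j * x0 \in H.
  have oHD : #|H * D| = (#|D| * p ^ j)%N.
    have := mul_cardG H D; rewrite HD oH => /eqP.
    by rewrite mulnAC -mulnA mulnC eqn_pmul2r ?cardG_gt0 // mulnC => /eqP <-.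
  have cHD : commute H D by apply: centC; rewrite (centSS _ _ abF).
  have HDg : H * D = H <*> D by rewrite comm_joingE.
  have sDHD : D \subset H <*> D by apply: joing_subr.
  have sHDF : H <*> D \subset F by rewrite join_subG sHF.
  have defHD : D * (<[z]> :&: (H <*> D)) = H <*> D.
    by rewrite group_modl // DZ; apply/setIidPr; exact: sHDF.
  have oI : #|<[z]> :&: (H <*> D)| = (p ^ j)%N.
    have := oHD; rewrite HDg -[in X in X -> _]defHD TI_cardMg; last first.
      by apply/trivgP; rewrite -tiDZ setIS ?subsetIl.
    by move/eqP; rewrite eqn_pmul2l ?cardG_gt0 // => /eqP.
  have eqI : <[z]> :&: (H <*> D) = <[zj j]>.
    apply/eqP; rewrite (eq_subG_cyclic (cycle_cyclic z)) ?subsetIl ?cycleX //.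
    by rewrite oI -orderE zj_order.
  have: zj j \in H * D.
    by rewrite HDg; apply: (subsetP (subsetIr <[z]> _)); rewrite eqI cycle_id.
  case/mulsgP=> h d hH dD zE; exists d^-1; rewrite ?groupV //.
  by rewrite zE mulgK.
rewrite -sum1_card [RHS](reindex_inj (mulgI x0)); apply: eq_bigl => k /=.
have HDE u : u \in D -> (u \in H) = (u \in K) by rewrite -HD inE => ->;
  rewrite andbT.
rewrite inE groupMl //.
have -> : (k \in K) = (k \in D) && (zj j * (x0 * k) \in H).
  rewrite mulgA groupMl //; case kD: (k \in D); first by rewrite HDE.
  by apply: contraFF kD => /(subsetP sKD).
case kD: (k \in D) => //=; have xkD : x0 * k \in D by rewrite groupM.
apply/idP/idP => [xH|/andP[_ /eqP <-]]; last first.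
  by rewrite -cycle_subG /= joing_subr.
(* As [zj j] has order [p ^ j], this power equals that of [zj j * (x0 * k)], so it lies in both [H]
   and [D]. *)
have xK : (x0 * k) ^+ (p ^ j) \in K.
  rewrite -(HDE _ (groupX _ xkD)) -(mul1g ((x0 * k) ^+ (p ^ j))).
  rewrite -(expg_order (zj j)) zj_order //.
  by rewrite -expgMn ?groupX //; apply: comF => //; apply: (subsetP sDF).
rewrite xK /= -val_eqE eqEcard /= join_subG cycle_subG xH -{1}HD subsetIl /=.
by rewrite card_cyclic_ext // oH.
Qed.

(** * Weighted sums over subgroups and their recursion *)

Section WeightedSum.
Local Open Scope ring_scope.
Variables (R : numFieldType) (w : nat -> R).
Hypothesis pF : p.-group F.

(** Subgroups [H] are sorted by [K = H :&: D] and then by the [j] with [#|H : K| = p ^ j]; each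
    class is counted by [card_cyclic_ext_fibre]. *)
Lemma sum_subgroups_cyclic_factor :
  \sum_(H : {group gT} | H \subset F) w #|H| =
  \sum_(K : {group gT} | K \subset D) \sum_(j < n.+1)
     w (#|K| * p ^ j)%N *
     (#|[set x in D | (x ^+ (p ^ j))%g \in K]|%:R / #|K|%:R).
Proof.
rewrite (partition_big (fun H => H :&: D)%G (fun K : {group gT} =>
  K \subset D)) /=; last first.
  by move=> H _; apply: subsetIr.
apply: eq_bigr => K sKD.
rewrite (partition_big (fun H : {group gT} =>
  inord (logn p #|H : K|) : 'I_n.+1) xpredT) //=.
apply: eq_bigr => j _; have lejn : (j <= n)%N by rewrite -ltnS.
have nzK : #|K|%:R != 0 :> R by rewrite pnatr_eq0 -lt0n cardG_gt0.
rewrite -card_cyclic_ext_fibre // natrM mulfK //.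
rewrite mulr_natr -sumr_const; apply/esym/eq_big => [H|H]; last first.
  by rewrite inE => /and3P[_ _ /eqP->].
have eqG : ((H :&: D)%G == K) = (H :&: D == K :> {set gT}) by [].
apply/esym; rewrite inE eqG -andbA; case sHF: (H \subset F) => //=.
apply: andb_id2l => /eqP defK; have sKH : K \subset H by rewrite -defK subsetIl.
have pH : p.-group H := pgroupS sHF pF.
have [m iHK] := p_natP (pnat_dvd (dvdn_indexg H K) pH).
(* The index of [K] in [H] is that of [D] in [H * D], hence at most [#[z]]; this keeps [inord] from
   falling back on its default. *)
have lemn : (m <= n)%N.
  rewrite -(leq_exp2l _ _ (prime_gt1 p_prime)) -iHK -oz orderE.
  have leHD : (#|(H * D)%g| <= #|D| * #|<[z]>|)%N.
    by rewrite -(TI_cardMg tiDZ) DZ subset_leq_card // mul_subG.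
  rewrite -(@leq_pmul2l (#|K| * #|D|)) ?muln_gt0 ?cardG_gt0 //.
  rewrite mulnAC Lagrange // mul_cardG defK mulnC -mulnA.
  by rewrite leq_pmul2l ?cardG_gt0.
rewrite -(Lagrange sKH) iHK pfactorK // -val_eqE /= inordK ?ltnS //.
by rewrite eqn_pmul2l ?cardG_gt0 // eqn_exp2l ?prime_gt1.
Qed.

Hypothesis expD : {in D, forall x, (x ^+ (p ^ n))%g = 1%g}.

(** Here [p ^ m] is the order of the coset of [x] modulo [K]; [expD] bounds it by [p ^ n]. *)
Lemma join_cycle_order (K : {group gT}) x : K \subset D -> x \in D ->
  exists m, [/\ (m <= n)%N, #|K <*> <[x]>| = (#|K| * p ^ m)%N
             & forall j, ((x ^+ (p ^ j))%g \in K) = (m <= j)%N].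
Proof.
move=> sKD xD; have xF : x \in F := subsetP sDF x xD.
have sKF : K \subset F := subset_trans sKD sDF.
have nKx : x \in 'N(K) by apply: subsetP xF; apply: sub_abelian_norm.
have inK i : ((x ^+ i)%g \in K) = (#[coset K x] %| i)%N.
  rewrite order_dvdn -morphX //; apply/idP/eqP => [/coset_id//|].
  by apply: coset_idr; rewrite groupX.
have [m om] : exists m, #[coset K x] = (p ^ m)%N.
  have px : p.-elt (coset K x) by apply: morph_p_elt => //;
    apply: mem_p_elt pF xF.
  by have [m om] := p_natP px; exists m.
exists m; split=> [||j]; last by rewrite inK om dvdn_Pexp2l ?prime_gt1.
  by rewrite -(dvdn_Pexp2l _ _ (prime_gt1 p_prime)) -om -inK expD.
have nKX : <[x]> \subset 'N(K) by rewrite cycle_subG.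
rewrite -om orderE -quotient_cycle // -quotientYidl // card_quotient ?join_subG
  ?normG //.
by rewrite Lagrange // joing_subl.
Qed.

(** The condition says that the coset of [x] generates [L / K], and each generator has [#|K|]
    lifts. *)
Lemma card_join_cycle_eq (K L : {group gT}) : K \subset L -> L \subset D ->
  #|[set x in D | K <*> <[x]> == L]|
    = (#|[set y | generator (L / K)%g y]| * #|K|)%N.
Proof.
move=> sKL sLD; have nKL : L \subset 'N(K).
  by apply: (subset_trans (subset_trans sLD sDF)); apply: sub_abelian_norm;
    rewrite ?(subset_trans sKL) ?(subset_trans sLD).
rewrite -sum_nat_const -[LHS]sum1_card.
rewrite (partition_big (coset K) (fun y =>
  y \in [set y | generator (L / K)%g y])) /=; last first.
  move=> x; rewrite !inE => /andP[xD /eqP eL].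
  have xL : x \in L by rewrite -eL -cycle_subG joing_subr.
  have nKx : <[x]> \subset 'N(K) by rewrite cycle_subG (subsetP nKL).
  by rewrite /generator -eL quotientYidl // quotient_cycle // -cycle_subG.
apply: eq_bigr => y; rewrite inE => geny.
have yLK : y \in (L / K)%g by rewrite (eqP geny) cycle_id.
have /morphimP[x0 nKx0 x0L def_y] := yLK.
rewrite -sum1_card (reindex_inj (mulgI x0)); apply: eq_bigl => k /=;
  rewrite inE.
apply/idP/idP => [/andP[/andP[kD /eqP eL] /eqP ey]|kK].
  have x0kL : (x0 * k)%g \in L by rewrite -eL -cycle_subG joing_subr.
  have kL : k \in L by rewrite -(groupMl k x0L).
  have nKk := subsetP nKL k kL.
  apply: coset_idr => //; apply: (mulgI (coset K x0)).
  by rewrite -morphM //= ey mulg1.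
have x0kL : (x0 * k)%g \in L by rewrite groupM // (subsetP sKL).
have nKx0k := subsetP nKL _ x0kL.
have ey : coset K (x0 * k)%g = y by rewrite coset_kerr.
rewrite ey eqxx andbT (subsetP sLD) //= eqEsubset join_subG sKL cycle_subG x0kL
  /=.
rewrite -(quotientSGK nKL) ?joing_subl // quotientYidl ?cycle_subG //.
by rewrite quotient_cycle // ey -(eqP geny).
Qed.

(** The evaluation of the correction term [T], for a general weight [f]: grouping by [L] cancels
    [#|K|], and [sum_quotient_generators] sums over [K] for fixed [L]. *)
Lemma sum_join_cycle (f : nat -> R) :
  \sum_(K : {group gT} | K \subset D) \sum_(x in D) f #|K <*> <[x]>| / #|K|%:R =
  \sum_(L : {group gT} | L \subset D) f #|L| * #|L|%:R.
Proof.
have abD : abelian D := abelianS sDF abF.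
transitivity (\sum_(K : {group gT} | K \subset D)
   \sum_(L : {group gT} | (L \subset D) && (K \subset L))
   f #|L| * #|[set y | generator (L / K)%g y]|%:R).
  apply: eq_bigr => K sKD.
  rewrite (partition_big (fun x => K <*> <[x]>)%G (fun L : {group gT} =>
    (L \subset D) && (K \subset L))) /=; last first.
    by move=> x xD; rewrite joing_subl join_subG sKD cycle_subG xD.
  apply: eq_bigr => L /andP[sLD sKL].
  have nzK : #|K|%:R != 0 :> R by rewrite pnatr_eq0 -lt0n cardG_gt0.
  transitivity (f #|L| / #|K|%:R *+ #|[set x in D | K <*> <[x]> == L]|).
    rewrite -[RHS]sumr_const; apply: eq_big => [x|x /andP[_ /eqP <-]//].
    by rewrite inE.
  by rewrite card_join_cycle_eq // -mulr_natr natrM; field.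
rewrite (exchange_big_dep (fun L : {group gT} => L \subset D)) /=;
  last by move=> K L _ /andP[].
apply: eq_bigr => L sLD; rewrite -mulr_sumr; congr (_ * _).
rewrite -natr_sum -[in RHS](sum_quotient_generators (abelianS sLD abD));
  congr _%:R.
apply: eq_bigl => K; rewrite sLD /=; case sKL: (K \subset L);
  rewrite ?andbF ?andbT //.
exact: subset_trans sKL sLD.
Qed.

(** For fixed [K] and [x], the admissible [j] run from the [m] of [join_cycle_order] to [n]. Their
    geometric series telescopes to [q ^+ n.+1 - q ^+ m], and [w #|K| * q ^+ m] is the weight of the
    subgroup generated by [K] and [x]. *)
Lemma sum_subgroups_rec (q : R) :
    (forall k j, (0 < k)%N -> w (k * p ^ j)%N = w k * q ^+ j) ->
  (q - 1) * \sum_(H : {group gT} | H \subset F) w #|H| =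
  q ^+ n.+1 * #|D|%:R * (\sum_(K : {group gT} | K \subset D) w #|K| / #|K|%:R)
  - \sum_(L : {group gT} | L \subset D) w #|L| * #|L|%:R.
Proof.
move=> wM; rewrite sum_subgroups_cyclic_factor -sum_join_cycle !mulr_sumr
  -sumrB.
apply: eq_bigr => K sKD.
have w_in j : w (#|K| * p ^ j)%N = w #|K| * q ^+ j by rewrite wM ?cardG_gt0.
transitivity (\sum_(x in D)
  (w #|K| * q ^+ n.+1 / #|K|%:R - w #|K <*> <[x]>| / #|K|%:R)); last first.
  by rewrite sumrB sumr_const -mulr_natr; congr (_ - _); ring.
(* The count of elements [x] is spelled out as a sum, so that [x] can be moved outside and [j]
   summed first. *)
rewrite mulr_sumr (eq_bigr (fun j : 'I_n.+1 =>
  \sum_(x in D | (x ^+ (p ^ j))%g \in K)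
    (q - 1) * q ^+ j * (w #|K| / #|K|%:R))) => [|j _]; last first.
  rewrite w_in (eq_bigl (mem [set x in D | (x ^+ (p ^ j))%g \in K]));
    last first.
    by move=> x; rewrite !inE.
  by rewrite [RHS]sumr_const -[RHS]mulr_natr; ring.
rewrite (exchange_big_dep (mem D)) /=; last by move=> j x _ /andP[].
apply: eq_bigr => x xD.
have [m [lemn oKx xK]] := join_cycle_order sKD xD.
under eq_bigl => j do rewrite xD xK /=.
rewrite oKx w_in.
have geo k : (m <= k)%N ->
  (q - 1) * (\sum_(j < k | (m <= j)%N) q ^+ j) = q ^+ k - q ^+ m.
  elim: k => [|k IHk]; first by rewrite leqn0 => /eqP->;
    rewrite big_ord0 mulr0 subrr.
  rewrite leq_eqVlt => /orP[/eqP<-|].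
    rewrite big1 ?mulr0 ?subrr // => j; rewrite leqNgt ltn_ord //.
  rewrite ltnS => lemk; rewrite big_mkcond big_ord_recr /= lemk -big_mkcond
    mulrDr IHk // exprS; ring.
rewrite -mulr_suml -mulr_sumr geo ?(leq_trans lemn) //; ring.
Qed.

End WeightedSum.
End CyclicFactor.

Local Open Scope ring_scope.
Local Open Scope complex_scope.

(** * Complex powers of positive integers *)

Section ComplexPowers.
Variable R : realType.
Implicit Types (a b z : R[i]) (n k : nat).

Lemma cexpD z1 z2 : cexp (z1 + z2) = cexp z1 * cexp z2.
Proof.
case: z1 z2 => [x1 y1] [x2 y2]; rewrite /cexp /=; simpc.
rewrite exp.expRD trigo.cosD trigo.sinD; congr (_ +i* _); ring.
Qed.

Lemma cexp_real (x : R) : cexp x%:C = (sequences.expR x)%:C.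
Proof. by rewrite /cexp /= trigo.cos0 trigo.sin0 mulr1 mulr0. Qed.

Lemma real_complexM (x y : R) : (x * y)%:C = x%:C * y%:C.
Proof. exact: (rmorphM (real_complex R)). Qed.

Lemma real_complexD (x y : R) : (x + y)%:C = x%:C + y%:C.
Proof. exact: (rmorphD (real_complex R)). Qed.

Lemma real_complex_nat k : (k%:R : R)%:C = k%:R.
Proof. exact: (rmorph_nat (real_complex R)). Qed.

Lemma cexp0 : cexp (0 : R[i]) = 1.
Proof. by rewrite (cexp_real 0) exp.expR0. Qed.

Lemma cpowD n a b : cpow n (a + b) = cpow n a * cpow n b.
Proof. by rewrite /cpow mulrDl cexpD. Qed.

Lemma cpow0 n : cpow n (0 : R[i]) = 1.
Proof. by rewrite /cpow mul0r cexp0. Qed.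

Lemma cpow_neq0 n a : cpow n a != 0.
Proof.
have: cpow n a * cpow n (- a) != 0 by rewrite -cpowD subrr cpow0 oner_neq0.
by rewrite mulf_eq0 negb_or => /andP[].
Qed.

Lemma cpowN n a : cpow n (- a) = (cpow n a)^-1.
Proof.
by apply: (mulfI (cpow_neq0 n a)); rewrite -cpowD subrr cpow0 divff ?cpow_neq0.
Qed.

Lemma cpowMr n a k : cpow n (a * k%:R) = cpow n a ^+ k.
Proof.
by elim: k => [|k IHk]; rewrite ?mulr0 ?cpow0 // -natr1 mulrDr mulr1 cpowD IHk
  exprSr.
Qed.

(** Every positive integer [k] thus occurs as a value of [q], which supplies infinitely many points
    for testing polynomial identities in [q]. *)
Lemma cpow_ratio n k : (0 < k)%N -> (1 < n)%N ->
  cpow n (exp.ln k%:R / exp.ln n%:R : R)%:C = k%:R.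
Proof.
move=> k_gt0 n_gt1; rewrite /cpow -real_complexM divfK; last first.
  by rewrite gt_eqF // exp.ln_gt0 // ltr1n.
by rewrite cexp_real exp.lnK ?posrE ?ltr0n // real_complex_nat.
Qed.

Lemma cpow1 n : (0 < n)%N -> cpow n (1 : R[i]) = n%:R.
Proof.
by move=> n_gt0; rewrite /cpow mul1r cexp_real exp.lnK ?posrE ?ltr0n //
  real_complex_nat.
Qed.

Lemma cpow_nat n k : (0 < n)%N -> cpow n (k%:R : R[i]) = n%:R ^+ k.
Proof. by move=> n_gt0; rewrite -[k%:R]mul1r cpowMr cpow1. Qed.

Lemma cpowMl n k a : (0 < n)%N -> (0 < k)%N ->
  cpow (n * k) a = cpow n a * cpow k a.
Proof.
move=> n_gt0 k_gt0; rewrite /cpow -cexpD -mulrDr -real_complexD natrM.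
by rewrite exp.lnM ?posrE ?ltr0n.
Qed.

Lemma cpowXl n k a : (0 < n)%N -> cpow (n ^ k) a = cpow n a ^+ k.
Proof.
move=> n_gt0; elim: k => [|k IHk].
  by rewrite /cpow exp.ln1 mulr0 cexp0.
by rewrite expnS cpowMl ?expn_gt0 ?n_gt0 // IHk exprS.
Qed.

End ComplexPowers.

(** * Splitting off the last sign in the closed form *)

Section ClosedForm.
Variables (R : realType) (p : nat).
Hypothesis p_prime : prime p.
Local Notation C := R[i].

(** The coefficient contributed by one sign vector. Taking [f] as a plain function lets the
    recursion restrict it by composition. *)
Definition rhs_monomial r (a : C) (eps : {ffun 'I_r -> bool})
    (f : 'I_r -> nat) : C :=
  \prod_(t < r) (rhs_coef p a eps t * rhs_pole p a eps t ^+ f t).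

Definition eps_rcons r (e : {ffun 'I_r -> bool}) (b : bool) :
    {ffun 'I_r.+1 -> bool} :=
  [ffun i => if unlift ord_max i is Some j then e j else b].

Lemma eps_rcons_max r e b : @eps_rcons r e b ord_max = b.
Proof. by rewrite ffunE unlift_none. Qed.

Lemma widen_lift r (t : 'I_r) : widen_ord (leqnSn r) t = lift ord_max t.
Proof. by apply: val_inj; rewrite /= /bump leqNgt ltn_ord. Qed.

Lemma eps_rcons_widen r e b t : @eps_rcons r e b (widen_ord (leqnSn r) t) = e t.
Proof. by rewrite ffunE widen_lift liftK. Qed.

Lemma sum_eps_rcons r (Phi : {ffun 'I_r.+1 -> bool} -> C) :
  \sum_eps Phi eps =
  \sum_e Phi (eps_rcons e true) + \sum_e Phi (eps_rcons e false).
Proof.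
rewrite -(big_bool _ (fun b => \sum_e Phi (eps_rcons e b))) pair_big /=.
rewrite (reindex (fun eb : bool * {ffun 'I_r -> bool} =>
  eps_rcons eb.2 eb.1)) //.
exists (fun eps : {ffun 'I_r.+1 -> bool} =>
  (eps ord_max, [ffun t => eps (widen_ord (leqnSn r) t)])) => [[b e]|eps] _ /=.
  by rewrite eps_rcons_max; congr (_, _); apply/ffunP => t;
    rewrite ffunE eps_rcons_widen.
apply/ffunP => i; rewrite ffunE; case: unliftP => [j ->|-> //].
by rewrite ffunE widen_lift.
Qed.

Variables (r : nat) (a : C) (e : {ffun 'I_r -> bool}) (b : bool).
Local Notation w := (widen_ord (leqnSn r)).
Local Notation eps := (eps_rcons e b).

(** Every proper tail ends with the last sign, so removing that sign amounts to shifting [a]. *)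
Lemma tail_exponent_rcons t :
  tail_exponent a eps (w t) = tail_exponent (a + sgn R b) e t.
Proof.
rewrite /tail_exponent big_mkcond big_ord_recr /= ltn_ord eps_rcons_max.
rewrite -addrA [sgn R b + _]addrC; congr (_ + (_ + _)); rewrite [RHS]big_mkcond.
by apply: eq_bigr => h _; rewrite eps_rcons_widen.
Qed.

Lemma tail_exponent_max : tail_exponent a eps ord_max = a.
Proof.
rewrite /tail_exponent big1 ?addr0 // => h.
by rewrite ltnNge -ltnS ltn_ord.
Qed.

Lemma tail_star_rcons t :
  tail_star R eps (w t) = tail_star R e t + star (sgn R b).
Proof.
rewrite /tail_star big_mkcond big_ord_recr /= (ltnW (ltn_ord t)) eps_rcons_max.
congr (_ + _); rewrite [RHS]big_mkcond.
by apply: eq_bigr => h _; rewrite eps_rcons_widen.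
Qed.

Lemma tail_star_max : tail_star R eps ord_max = star (sgn R b).
Proof.
rewrite /tail_star big_mkcond big_ord_recr /= leqnn eps_rcons_max big1 ?add0r
  //.
by move=> h _; rewrite leqNgt ltn_ord.
Qed.

Lemma star_sgn c : star (sgn R c) = c%:R.
Proof.
rewrite /star /sgn; case: c => /=; last by rewrite expr0 subrr mul0r.
by rewrite expr1 opprK -mulr2n divff ?pnatr_eq0.
Qed.

Lemma rhs_coef_rcons t : rhs_coef p a eps (w t) = rhs_coef p (a + sgn R b) e t.
Proof. by rewrite /rhs_coef tail_exponent_rcons eps_rcons_widen. Qed.

Lemma rhs_coef_max :
  rhs_coef p a eps ord_max = (if b then cpow p a else -1) / (cpow p a - 1).
Proof.
rewrite /rhs_coef tail_exponent_max eps_rcons_max star_sgn; congr (_ / _).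
by case: (b); rewrite /sgn /= ?expr1 ?opprK ?mul1r // mul0r cpow0 mulr1.
Qed.

(** Let [S] be the tail sum for [e]. A last sign [-1] turns it into [S + 1], and [(a + r + 1 - t)(S
    + 1) - (S + 1)^2 = (a - 1 + r - t) S - S^2 + (a + r - t)]. A last sign [+1] keeps [S], and the
    longer range is absorbed by [a + 1]. *)
Lemma rhs_pole_rcons t : rhs_pole p a eps (w t) =
  rhs_pole p (a + sgn R b) e t * (if b then cpow p a * p%:R ^+ (r - t) else 1).
Proof.
rewrite /rhs_pole tail_star_rcons star_sgn /= subSn; last exact: ltnW.
rewrite -natr1; case: (b); rewrite /sgn /= ?expr1 ?expr0.
  rewrite -cpow_nat ?prime_gt0 // -!cpowD; congr cpow; ring.
by rewrite mulr1; congr cpow; ring.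
Qed.

Lemma rhs_pole_max :
  rhs_pole p a eps ord_max = if b then cpow p a else 1.
Proof.
rewrite /rhs_pole tail_star_max star_sgn /= subSnn; case: (b) => /=.
  by congr cpow; ring.
by rewrite mulr0 expr0n subr0 cpow0.
Qed.

End ClosedForm.

(** * The recursion satisfied by the closed form *)

Section ClosedFormRec.
Variables (R : realType) (p : nat).
Hypothesis p_prime : prime p.
Local Notation C := R[i].

Lemma rhs_monomial_rcons r (a : C) e b (f : 'I_r.+1 -> nat) :
  let w := widen_ord (leqnSn r) in
  rhs_monomial p a (eps_rcons e b) f =
  (if b then cpow p a ^+ (f ord_max).+1 *
             \prod_(t < r) (cpow p a * p%:R ^+ (r - t)) ^+ f (w t)
   else -1) / (cpow p a - 1) * rhs_monomial p (a + sgn R b) e (f \o w).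
Proof.
move=> w; rewrite /rhs_monomial big_ord_recr /= rhs_coef_max rhs_pole_max.
under eq_bigr => t _ do
  rewrite rhs_coef_rcons rhs_pole_rcons // exprMn mulrA.
rewrite big_split /= -/w; case: b => /=; last first.
  have -> : \prod_(t < r) 1 ^+ f (w t) = 1 :> C by apply: big1 => t _;
    rewrite expr1n.
  by rewrite expr1n; ring.
by rewrite exprS; ring.
Qed.

Definition rhs_sum r (a : C) f :=
  \sum_(eps : {ffun 'I_r -> bool}) rhs_monomial p a eps f.

(** The two terms are the two values of the last sign. This matches [sum_subgroups_rec]: the powers
    of [cpow p a] collect to one more than the sum of all [f t], and the powers of [p] give the
    order of the product of the first [r] cyclic factors. *)
Lemma rhs_sum_rec r (a : C) (f : 'I_r.+1 -> nat) : cpow p a - 1 != 0 ->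
  let w := widen_ord (leqnSn r) in
  (cpow p a - 1) * rhs_sum a f =
  cpow p a ^+ (f ord_max).+1 *
    \prod_(t < r) (cpow p a * p%:R ^+ (r - t)) ^+ f (w t)
    * rhs_sum (a - 1) (f \o w) - rhs_sum (a + 1) (f \o w).
Proof.
move=> nz w; rewrite /rhs_sum sum_eps_rcons.
rewrite (eq_bigr _ (fun e _ => rhs_monomial_rcons a e true f)).
rewrite [X in _ * (_ + X)](eq_bigr _ (fun e _ =>
  rhs_monomial_rcons a e false f)).
rewrite /= -!mulr_sumr /sgn expr1 expr0; field.
exact: nz.
Qed.

End ClosedFormRec.

(** * Direct products of cyclic groups *)

Section BigDprod.
Local Open Scope group_scope.

Lemma bigdprod_cycle_exponent (gT : finGroupType) r (x : 'I_r -> gT)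
    (F : {group gT}) n :
    \big[dprod/1]_(i < r) <[x i]> = F -> (forall i, (#[x i] %| n)%N) ->
  abelian F /\ {in F, forall y, y ^+ n = 1}.
Proof.
elim: r x F => [|r IHr] x F.
  rewrite big_ord0 => <- _; split; first exact: abelian1.
  by move=> y /set1gP->; rewrite expg1n.
rewrite big_ord_recr /= => defF dvn;
  have [[D Z defD defZ] defM cDZ tiDZ] := dprodP defF.
have [abD expD] := IHr _ D defD (fun i => dvn _).
rewrite defD defZ in defM cDZ.
have abZ : abelian Z by rewrite -defZ cycle_abelian.
split=> [|y]; first by rewrite -defM abelianM abD abZ.
rewrite -defM => /mulsgP[d c dD cZ ->].
rewrite expgMn; last by apply/commute_sym; apply: (centsP cDZ).
rewrite expD // mul1g; move: cZ; rewrite -defZ => /cycleP[i ->].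
have xn1 : x ord_max ^+ n = 1 by apply/eqP; rewrite -order_dvdn.
by rewrite -expgM mulnC expgM xn1 expg1n.
Qed.

Lemma Zp_generator n : (0 < n)%N -> exists2 y : 'Z_n, Zp n = <[y]> & #[y] = n.
Proof.
(* For [n = 1] the group is trivial although the type has two elements, so the generator is the
   identity. *)
rewrite /Zp; case: n => [|[|n]] //= _; first by exists 1;
  rewrite ?cycle1 ?order1.
exists Zp1; first by rewrite Zp_cycle.
by rewrite orderE -Zp_cycle cardsT card_ord.
Qed.

End BigDprod.

(** This computes the exponent of [p] in the order of the group: [f j] enters the [r - j] partial
    sums from index [j] on. *)
Lemma sum_partial_sums r (f : 'I_r -> nat) :
  (\sum_(i < r) \sum_(j < r | (j <= i)%N) f j = \sum_(j < r) (r - j) * f j)%N.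
Proof.
rewrite (exchange_big_dep xpredT) //=; apply: eq_bigr => j _.
by rewrite -(big_geq_mkord _ _ xpredT (fun=> f j)) sum_nat_const_nat.
Qed.

(** * The explicit formula for [sigma] *)

Section Sigma.
Variables (R : realType) (p : nat).
Hypothesis p_prime : prime p.
Local Notation C := R[i].

(** No denominator of the explicit formula vanishes. Ranging over all signs makes the condition pass
    from [a] to [a - 1] and [a + 1], one factor fewer each time. *)
Definition nonsingular r (a : C) :=
  forall (eps : {ffun 'I_r -> bool}) t, cpow p (tail_exponent a eps t) - 1 != 0.

Lemma nonsingular_rec r a : nonsingular r.+1 a ->
  [/\ cpow p a - 1 != 0, nonsingular r (a - 1) & nonsingular r (a + 1)].
Proof.
move=> ns; have nsb b : nonsingular r (a + sgn R b).
  by move=> e t; rewrite -tail_exponent_rcons; apply: ns.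
split; last 2 first.
- by have := nsb true; rewrite /sgn expr1.
- by have := nsb false; rewrite /sgn expr0.
by have := ns (eps_rcons [ffun=> true] true) ord_max; rewrite tail_exponent_max.
Qed.

Lemma sigma_dprod_rec (gT : finGroupType) (D F : {group gT}) z n (a : C) :
    (D \x <[z]> = F)%g -> abelian F -> #[z]%g = (p ^ n)%N -> pgroup p F ->
    {in D, forall x, (x ^+ (p ^ n) = 1)%g} ->
  (cpow p a - 1) * sigma a F =
  cpow p a ^+ n.+1 * #|D|%:R * sigma (a - 1) D - sigma (a + 1) D.
Proof.
move=> defF abF oz pF expD.
rewrite /sigma (sum_subgroups_rec p_prime defF abF oz pF (w := fun k =>
  cpow k a) expD (q := cpow p a)) //.
  congr (_ * _ - _); apply: eq_bigr => K _.
    by rewrite cpowD cpowN cpow1 ?cardG_gt0.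
  by rewrite cpowD cpow1 ?cardG_gt0.
move=> k j k_gt0; have p_gt0 := prime_gt0 p_prime.
by rewrite cpowMl ?expn_gt0 ?p_gt0 // cpowXl.
Qed.

(** Induction on the number of factors, removing the last one. Internal direct products keep the
    smaller group inside the same [gT]. *)
Lemma sigma_bigdprod r (a : C) (gT : finGroupType) (F : {group gT})
    (x : 'I_r -> gT) (f : 'I_r -> nat) :
    (\big[dprod/1]_(i < r) <[x i]> = F)%g ->
    (forall i, #[x i]%g = p ^ \sum_(j < r | (j <= i)%N) f j)%N ->
    nonsingular r a ->
  sigma a F = rhs_sum p a f.
Proof.
have p_gt0 := prime_gt0 p_prime.
elim: r a F x f => [|r IHr] a F x f.
  rewrite big_ord0 => defF _ _; rewrite /sigma (big_pred1 1%G); last first.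
    move=> H; rewrite -defF; apply/idP/eqP => [/trivgP H1|-> //].
    exact: group_inj.
  rewrite cards1 -(expn0 p) cpowXl // expr0 /rhs_sum /rhs_monomial.
  rewrite (eq_bigr (fun _ => 1)) => [|e _]; last by rewrite big_ord0.
  by rewrite sumr_const card_ffun card_ord expn0.
set n := (\sum_(j < r.+1) f j)%N.
move=> defF ox ns; have [nz ns1 ns2] := nonsingular_rec ns.
have oxmax : #[x ord_max]%g = (p ^ n)%N.
  by rewrite ox; congr (_ ^ _)%N; apply: eq_bigl => j; rewrite -ltnS ltn_ord.
(* The partial sums increase, so the last cyclic factor has the largest order and [p ^ n] kills all
   of [F], as the recursion requires of [D]. *)
have dvx i : (#[x i]%g %| p ^ n)%N.
  by rewrite ox dvdn_exp2l // /n [leqRHS](bigID (fun j : 'I_r.+1 =>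
    (j <= i)%N)) leq_addr.
have [abF expF] := bigdprod_cycle_exponent defF dvx.
have pF : pgroup p F.
  rewrite /pgroup -(bigdprod_card defF); elim/big_rec: _ => // i m _.
  by rewrite pnatM -orderE ox pnatX pnat_id.
move: (defF); rewrite big_ord_recr /= => defF'.
have [[D Z defD _] _ _ _] := dprodP defF'.
rewrite defD in defF'.
have sDF : D \subset F by case/dprodP: defF' => _ <- _ _; apply: mulG_subl.
pose w := widen_ord (leqnSn r).
have oxw i : (#[x (w i)]%g = p ^ \sum_(j < r | (j <= i)%N) (f \o w) j)%N.
  rewrite ox; congr (_ ^ _)%N;
    rewrite big_mkcond big_ord_recr /= leqNgt ltn_ord addn0.
  by rewrite -big_mkcond.
apply: (mulfI nz); rewrite rhs_sum_rec //.
rewrite (sigma_dprod_rec _ defF' abF oxmax pF) => [|y yD];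
  last by rewrite expF // (subsetP sDF).
rewrite !(IHr _ D _ (f \o w) defD oxw) //; congr (_ * _ - _).
have -> : #|D| = (p ^ \sum_(j < r) (r - j) * f (w j))%N.
  rewrite -(bigdprod_card defD) -sum_partial_sums expn_sum;
    apply: eq_bigr => i _.
  by rewrite -orderE oxw.
rewrite /n big_ord_recr /= -addnS addnC exprD -mulrA; congr (_ * _).
rewrite natrX !expr_sum -big_split; apply: eq_bigr => t _ /=.
by rewrite exprMn exprM.
Qed.

(** Generators of the coordinate groups are transported by the injective embeddings [dfung1], which
    preserve orders. *)
Lemma pgrp_dprod r (f : 'X_{1..r}) : exists x : 'I_r -> _,
  (\big[dprod/1]_(i < r) <[x i]> = pgrp p f)%g /\
  forall i, #[x i]%g = (p ^ pexpo f i)%N.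
Proof.
have y_ i : exists y : 'Z_(p ^ pexpo f i),
    Zp (p ^ pexpo f i) = <[y]>%g /\ #[y]%g = (p ^ pexpo f i)%N.
  have [|y] := @Zp_generator (p ^ pexpo f i);
    first by rewrite expn_gt0 prime_gt0.
  by exists y.
have [y yP] := fin_all_exists y_.
exists (fun i => dfung1 (y i)); split=> [|i]; last first.
  by rewrite (order_injm (injm_dfung1 _ _)) ?inE //; case: (yP i).
rewrite /pgrp /= -setXn_dprod; apply: eq_bigr => i _.
rewrite -morphim_dfung1 -morphim_cycle ?inE //.
by congr (_ @* _)%g; case: (yP i) => Zpy _; rewrite -Zpy.
Qed.

Lemma sigma_series_rhs_sum r (a : C) : nonsingular r a ->
  forall f, sigma_series p r a f = rhs_sum p a f.
Proof.
move=> ns f; have [x [defF ox]] := pgrp_dprod f.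
exact: sigma_bigdprod defF ox ns.
Qed.

End Sigma.

(** * Cauchy products of series with separated variables *)

Section FpsProduct.
Variables (K : comNzRingType) (r : nat).
Implicit Types (A B : fps K r) (m u v : 'X_{1..r}) (t : 'I_r).

Lemma fps_mul_eq0 A B m : (forall u v, m = (u + v)%MM -> A u * B v = 0) ->
  fps_mul A B m = 0.
Proof. by move=> AB0; apply: big1 => k /eqP; apply: AB0. Qed.

Lemma fps_mul_unique A B m u v : m = (u + v)%MM ->
    (forall u' v', m = (u' + v')%MM -> u' != u -> A u' * B v' = 0) ->
  fps_mul A B m = A u * B v.
Proof.
move=> mE AB0.
have lu : (mdeg u < (mdeg m).+1)%N by rewrite ltnS mE mdegD leq_addr.
have lv : (mdeg v < (mdeg m).+1)%N by rewrite ltnS mE mdegD leq_addl.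
rewrite /fps_mul (bigD1 (BMultinom lu, BMultinom lv)) /=; last exact/eqP.
rewrite big1 ?addr0 // => -[k1 k2] /= /andP[/eqP mk ne].
apply: AB0 => //; apply: contraNneq ne => k1u.
apply/eqP; congr (_, _); apply: val_inj => //=.
by apply: (@addmI _ u); rewrite -{1}k1u -mk -mE.
Qed.

Lemma fps_mul_suml (I : finType) (A : I -> fps K r) B m :
  fps_mul (fun k => \sum_i A i k) B m = \sum_i fps_mul (A i) B m.
Proof.
by rewrite exchange_big; apply: eq_bigr => k _; rewrite mulr_suml.
Qed.

Lemma fps_mul_sumr (I : finType) A (P : I -> {mpoly K[r]}) m :
  fps_mul A (fps_of_mpoly (\sum_i P i)) m
    = \sum_i fps_mul A (fps_of_mpoly (P i)) m.
Proof.
rewrite exchange_big; apply: eq_bigr => k _.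
by rewrite /fps_of_mpoly raddf_sum mulr_sumr.
Qed.

Lemma fps_mul_monomial A c u m :
  fps_mul A (fps_of_mpoly (c *: 'X_[u])) m =
  if (u <= m)%MM then c * A (m - u)%MM else 0.
Proof.
have coefX v : fps_of_mpoly (c *: 'X_[u] : {mpoly K[r]}) v = c * (u == v)%:R.
  by rewrite /fps_of_mpoly mcoeffZ mcoeffX.
case: ifP => [leum|/negbT nle].
  have mE : m = (m - u + u)%MM by rewrite submK.
  rewrite (fps_mul_unique mE) => [|u' v' mE' ne].
    by rewrite coefX eqxx mulr1 mulrC.
  rewrite coefX; case: eqP => [uv|_]; last by rewrite !mulr0.
  by case/eqP: ne; rewrite mE' uv addmK.
apply: fps_mul_eq0 => u' v' mE; rewrite coefX.
case: eqP => [uv|_]; last by rewrite !mulr0.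
by case/negP: nle; rewrite mE uv lem_addl.
Qed.

Definition mnm_clear m t : 'X_{1..r} :=
  [multinom if u == t then 0%N else m u | u < r].

(** As [A] does not involve ['X_t], the whole [t]-component of [m] comes from the geometric
    factor. *)
Lemma fps_mul_geom c x t A m : (forall u, u t != 0%N -> A u = 0) ->
  fps_mul (fps_scale c (fps_geom x t)) A m
  = c * x ^+ m t * A (mnm_clear m t).
Proof.
move=> A0; set u := (U_(t) *+ m t)%MM.
have ut : u t = m t by rewrite mulmnE mnm1E eqxx mul1n.
have mE : m = (u + mnm_clear m t)%MM.
  apply/mnmP => s; rewrite mnmDE mulmnE mnm1E mnmE eq_sym.
  by case: eqP => [->|_]; rewrite ?mul1n ?addn0.
rewrite (@fps_mul_unique _ _ _ _ _ mE) /fps_scale /fps_geom ?ut ?eqxx //.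
move=> u' v' mE' ne; case: eqP => [u'E|_]; last by rewrite mulr0 mul0r.
rewrite (A0 v') ?mulr0 //; apply: contraNneq ne => v't0.
by rewrite u'E /u mE' mnmDE v't0 addn0.
Qed.

Lemma fps_mul_geom_prod (c x : 'I_r -> K) m :
  (\big[@fps_mul K r/@fps_one K r]_(t < r) fps_scale (c t) (fps_geom (x t) t)) m
  = \prod_(t < r) (c t * x t ^+ m t).
Proof.
(* For a partial product over [s], the coefficient vanishes as soon as [m] involves a variable
   outside [s]; the induction needs this case. *)
suff H s : uniq s -> forall m,
    (\big[@fps_mul K r/@fps_one K r]_(t <- s)
       fps_scale (c t) (fps_geom (x t) t)) m
    = if [forall t, (t \notin s) ==> (m t == 0%N)]
      then \prod_(t <- s) (c t * x t ^+ m t) else 0.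
  rewrite H ?index_enum_uniq //; case: ifP => // /negP[]; apply/forallP => t.
  by rewrite mem_index_enum.
elim: s => [_ {}m|t s IHs /= /andP[ts us] {}m].
  rewrite !big_nil /fps_one /fps_of_mpoly mcoeff1.
  case: forallP => [m0|nm0].
    rewrite (_ : m = 0%MM) ?eqxx //; apply/mnmP => t.
    by have := m0 t; rewrite in_nil mnm0E => /eqP.
  case: eqP => // m0; case: nm0 => t; by rewrite m0 mnm0E implybT.
rewrite big_cons fps_mul_geom => [|u ut]; last first.
  by rewrite IHs //; case: ifP => // /forallP/(_ t); rewrite ts (negbTE ut).
rewrite IHs // big_cons.
have -> : [forall u, (u \notin s) ==> (mnm_clear m t u == 0%N)]
        = [forall u, (u \notin t :: s) ==> (m u == 0%N)].
  apply: eq_forallb => u; rewrite in_cons negb_or mnmE.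
  by case: (u == t); rewrite /= ?implybT.
case: ifP => _; last by rewrite mulr0.
congr (_ * _); apply: eq_big_seq => u us'; rewrite mnmE.
by case: eqP us' => // ->; rewrite (negbTE ts).
Qed.

(** The product splits into one-variable convolutions. The common bound [N] lets the product of sums
    expand over functions from ['I_r] to ['I_N]. *)
Lemma fps_mul_separated N (h : 'I_r -> nat -> K) (b : 'I_r -> {poly K}) m :
    (forall t, (size (b t) <= N)%N) ->
  fps_mul (fun k => \prod_(t < r) h t (k t))
    (fps_of_mpoly (\prod_(t < r) (map_poly (@mpolyC r K) (b t)).['X_t])) m
  = \prod_(t < r) \sum_(i < N | (i <= m t)%N) (b t)`_i * h t (m t - i)%N.
Proof.
move=> sb.
have hornerE t : (map_poly (@mpolyC r K) (b t)).['X_t]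
  = \sum_(i < N) (b t)`_i *: 'X_t ^+ i.
  rewrite (@horner_coef_wide _ N) ?(leq_trans (size_poly _ _)) //.
  by apply: eq_bigr => i _; rewrite coef_map mul_mpolyC.
under eq_bigr do rewrite hornerE.
rewrite bigA_distr_bigA /= fps_mul_sumr.
under [RHS]eq_bigr do rewrite big_mkcond.
rewrite [RHS]bigA_distr_bigA; apply: eq_bigr => g _.
pose u : 'X_{1..r} := [multinom nat_of_ord (g t) | t < r].
have -> : \prod_(t < r) ((b t)`_(g t) *: 'X_t ^+ (g t))
  = (\prod_t (b t)`_(g t)) *: 'X_[u] :> {mpoly K[r]}.
  rewrite scaler_prod mpolyXE_id; congr (_ *: _).
  by apply: eq_bigr => t _; rewrite mnmE.
rewrite fps_mul_monomial; case: ifP => [/mnm_lepP leum|/negP nle].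
  rewrite -big_split; apply: eq_bigr => t _ /=.
  by have := leum t; rewrite mnmBE mnmE => ->.
have [t nlt] : exists t, ~~ (g t <= m t)%N.
  apply/existsP; rewrite -negb_forall; apply/negP => /forallP le; case: nle.
  by apply/mnm_lepP => t; rewrite mnmE.
by rewrite (bigD1 t) //= (negbTE nlt) mul0r.
Qed.

End FpsProduct.

(** Once [m t] reaches the degree of [b t], the convolution at [t] is [c t * x t ^+ m t] times the
    value of [b t] at [(x t)^-1], which is zero. *)
Lemma fps_mul_separated_eq0 (K : fieldType) r (c x : 'I_r -> K)
    (b : 'I_r -> {poly K}) (m : 'X_{1..r}) t :
    x t != 0 -> root (b t) (x t)^-1 -> (size (b t) <= (m t).+1)%N ->
  fps_mul (fun k : 'X_{1..r} => \prod_(t < r) (c t * x t ^+ k t))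
    (fps_of_mpoly (\prod_(t < r) (map_poly (@mpolyC r K) (b t)).['X_t])) m = 0.
Proof.
move=> xt0 /rootP bx0 sbm.
pose N := \max_(t < r) size (b t).
rewrite (@fps_mul_separated _ _ N (fun t k => c t * x t ^+ k)); last first.
  by move=> s; apply: (leq_bigmax s).
apply/eqP; rewrite prodf_seq_eq0; apply/hasP; exists t;
  rewrite ?mem_index_enum //=.
apply/eqP; transitivity (c t * x t ^+ m t * (b t).[(x t)^-1]);
  last by rewrite bx0 mulr0.
rewrite (@horner_coef_wide _ N) ?(leq_bigmax t) // mulr_sumr big_mkcond.
apply: eq_bigr => i _; case: ifP => [le|/negbT nle].
  rewrite -[in RHS](subnK le) exprD exprVn; field; exact: expf_neq0.
by rewrite nth_default ?mul0r ?mulr0 // (leq_trans sbm) // ltnNge.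
Qed.

Lemma rhs_seriesE (R : realType) p r (a : R[i]) m :
  rhs_series p r a m = rhs_sum p a m.
Proof. by apply: eq_bigr => eps _; apply: fps_mul_geom_prod. Qed.

(** * The denominator [B_r] over a general ring *)

Section Denominator.
Variables (K : comNzRingType) (r : nat) (x y : K).

Definition Bcoef (t : 'I_r) j := y ^+ j * x ^+ ((r - t) * j - j ^ 2).

Definition Bfactor (t : 'I_r) : {poly K} :=
  \prod_(j < (r - t).+1) (1 - Bcoef t j *: 'X).

(** The ring is left free so that [y] can be either the number [q] or the indeterminate of
    [{poly rat}]. *)
Definition Bgen : {mpoly K[r]} :=
  \prod_(t < r) \prod_(j < (r - t).+1) (1 - Bcoef t j *: 'X_t).

Lemma Bgen_Bfactor :
  Bgen = \prod_(t < r) (map_poly (@mpolyC r K) (Bfactor t)).['X_t].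
Proof.
apply: eq_bigr => t _; rewrite rmorph_prod horner_prod; apply: eq_bigr => j _.
by rewrite rmorphB rmorph1 /= map_polyZ map_polyX !hornerE mul_mpolyC.
Qed.

Lemma size_Bfactor t : (size (Bfactor t) <= (r - t).+2)%N.
Proof.
apply: leq_trans (size_poly_prod_leq _ _) _.
rewrite leq_subLR card_ord addnS ltnS.
have : (\sum_(j < (r - t).+1) size (1 - Bcoef t j *: 'X)%R
        <= \sum_(j < (r - t).+1) 2)%N.
  apply: leq_sum => j _; apply: leq_trans (size_polyD _ _) _.
  rewrite geq_max size_poly1 size_polyN (leq_trans (size_scale_leq _ _))
    ?size_polyX //.
by rewrite sum_nat_const card_ord muln2 -addnn.
Qed.

Lemma Bgen_coef0 : Bgen@_0%MM = 1.
Proof.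
rewrite /Bgen -[LHS]/(mcoeff 0%MM _) rmorph_prod big1 // => t _.
rewrite rmorph_prod big1 // => j _.
by rewrite rmorphB /= mcoeff1 eqxx mcoeffZ mcoeffX mnm1_eq0 mulr0 subr0.
Qed.

End Denominator.

Lemma Bgen_map (K L : comNzRingType) (h : {rmorphism K -> L}) r x y :
  map_mpoly h (Bgen r x y) = Bgen r (h x) (h y).
Proof.
rewrite /Bgen rmorph_prod; apply: eq_bigr => t _.
rewrite rmorph_prod; apply: eq_bigr => j _.
by rewrite rmorphB rmorph1 /= map_mpolyZ map_mpolyX /Bcoef rmorphM !rmorphXn.
Qed.

Lemma eq_fps_mull (K : comNzRingType) r (A A' B : fps K r) : A =1 A' ->
  fps_mul A B =1 fps_mul A' B.
Proof. by move=> eqA m; apply: eq_bigr => k _; rewrite eqA. Qed.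

Lemma fps_mul_rmorph (K L : comNzRingType) (h : {rmorphism K -> L}) r
    (A B : fps K r) m :
  h (fps_mul A B m) = fps_mul (h \o A) (h \o B) m.
Proof. by rewrite rmorph_sum; apply: eq_bigr => k _; rewrite rmorphM. Qed.

(** The naturals are distinct in characteristic zero, and [size c] roots are too many for a nonzero
    [c]. *)
Lemma poly_nat_roots (F : numFieldType) (c : {poly F}) n0 :
  (forall k, (n0 < k)%N -> root c k%:R) -> c = 0.
Proof.
move=> rootc; apply/eqP; apply: contraT => nzc.
pose s : seq F := [seq k%:R | k <- iota n0.+1 (size c)].
have := max_poly_roots nzc (rs := s).
rewrite size_map size_iota ltnn => -> //.
  by apply/allP => _ /mapP[k +->]; rewrite mem_iota => /andP[lek _];
    apply: rootc.
by rewrite map_inj_uniq ?iota_uniq // => i j /eqP; rewrite eqr_nat => /eqP.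
Qed.

(** * Coefficients of the numerator as polynomials in [q] *)

Section Rational.
Variables (R : realType) (p r : nat).
Hypothesis p_prime : prime p.
Local Notation C := R[i].

(** The index [j] is the number of signs [-1] from position [t] on; so each pole is cancelled by a
    factor of [B_r]. *)
Lemma rhs_poleE (a : C) (eps : {ffun 'I_r -> bool}) (t : 'I_r) :
  exists j : 'I_(r - t).+1, rhs_pole p a eps t = Bcoef p%:R (cpow p a) t j.
Proof.
pose s := (\sum_(h < r | (t <= h)%N) eps h)%N.
have les : (s <= r - t)%N.
  rewrite -[leqRHS]muln1 -sum_nat_const_nat big_geq_mkord /=.
  by apply: leq_sum => h _; apply: leq_b1.
exists (inord s); rewrite /Bcoef inordK ?ltnS // /rhs_pole.
have -> : tail_star R eps t = s%:R.
  by rewrite natr_sum; apply: eq_bigr => h _; rewrite star_sgn.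
rewrite -(cpow_nat _ _ (prime_gt0 p_prime)) -cpowMr -cpowD; congr cpow.
have le2 : (s ^ 2 <= (r - t) * s)%N by rewrite -mulnn leq_mul2r les orbT.
rewrite (natrB _ le2).
by rewrite natrM natrX; ring.
Qed.

(** For each sign vector, the inverse of the pole at [t] is a root of [Bfactor], whose degree is at
    most [r - t + 1], hence at most [m t]. *)
Lemma sigma_mul_B_eq0 (a : C) (m : 'X_{1..r}) (t : 'I_r) : nonsingular p r a ->
  (r - t < m t)%N ->
  fps_mul (sigma_series p r a) (fps_of_mpoly (Bgen r p%:R (cpow p a))) m = 0.
Proof.
move=> ns ltm; rewrite (eq_fps_mull _ (sigma_series_rhs_sum p_prime ns)).
rewrite Bgen_Bfactor fps_mul_suml big1 // => eps _.
have [j poleE] := rhs_poleE a eps t.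
have nz : rhs_pole p a eps t != 0 by apply: cpow_neq0.
apply: (fps_mul_separated_eq0 _ nz); last first.
  by apply: leq_trans (size_Bfactor _ _ _) _.
rewrite /root /Bfactor horner_prod (bigD1 j) //= -poleE.
by rewrite !hornerE divff // subrr mul0r.
Qed.

(** With [q = k], a vanishing denominator would mean [k * p ^ u = p ^ v], where [u] and [v] count
    the signs [+1] and [-1] after [t]; then [k <= p ^ v <= p ^ r]. *)
Lemma nonsingular_ratio k : (p ^ r < k)%N ->
  nonsingular p r (exp.ln k%:R / exp.ln p%:R : R)%:C.
Proof.
move=> ltk eps t; have p_gt1 := prime_gt1 p_prime.
have p_gt0 := ltnW p_gt1.
have k_gt0 : (0 < k)%N by apply: leq_ltn_trans ltk.
pose u := (\sum_(h < r | (t < h)%N) ~~ eps h)%N.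
pose v := (\sum_(h < r | (t < h)%N) eps h)%N.
have lev : (v <= r)%N.
  apply: (@leq_trans (\sum_(h < r | (t < h)%N) 1)%N);
    first by apply: leq_sum => h _; apply: leq_b1.
  by rewrite sum1_card -[leqRHS]card_ord max_card.
have -> : tail_exponent (exp.ln k%:R / exp.ln p%:R : R)%:C eps t
    = (exp.ln k%:R / exp.ln p%:R : R)%:C + u%:R - v%:R.
  rewrite -addrA; congr (_ + _); rewrite !natr_sum -sumrB;
    apply: eq_bigr => h _.
  by rewrite /sgn; case: (eps h); rewrite /= ?expr1 ?expr0 ?sub0r ?subr0.
rewrite !cpowD cpowN cpow_ratio // !cpow_nat // subr_eq0.
apply: contraTneq ltk => E.
have := congr1 ( *%R^~ (p%:R ^+ v)) E; rewrite /= mul1r divfK; last first.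
  by rewrite expf_neq0 // pnatr_eq0 -lt0n prime_gt0.
rewrite -!natrX -natrM => /eqP; rewrite eqr_nat => /eqP kE.
rewrite -leqNgt; apply: leq_trans (_ : k * p ^ u <= _)%N.
  by rewrite leq_pmulr // expn_gt0 prime_gt0.
by rewrite kE leq_exp2l.
Qed.

(** The value of [sigma] with [q] kept as an indeterminate: a subgroup of order [p ^ k] contributes
    the [k]-th power of [q]. *)
Definition sigma_poly (f : 'X_{1..r}) : {poly rat} :=
  \sum_(H : {group _} | H \subset pgrp p f) 'X^(logn p #|H|).

Definition numerator_coef (m : 'X_{1..r}) : {poly rat} :=
  fps_mul sigma_poly (fps_of_mpoly (Bgen r p%:R 'X)) m.

Lemma card_pgrp (f : 'X_{1..r}) : #|pgrp p f| = (p ^ \sum_(i < r) pexpo f i)%N.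
Proof.
have [x [defF ox]] := pgrp_dprod p_prime f.
by rewrite -(bigdprod_card defF) expn_sum; apply: eq_bigr => i _;
  rewrite -orderE ox.
Qed.

Definition qeval_comm (q : C) : commr_rmorph (@ratr C) q :=
  fun c => mulrC q (ratr c).

Lemma qeval_sigma_poly (a : C) f :
  horner_morph (qeval_comm (cpow p a)) (sigma_poly f) = sigma_series p r a f.
Proof.
rewrite /sigma_poly rmorph_sum; apply: eq_bigr => H sHF.
rewrite rmorphXn /= horner_morphX -cpowXl ?prime_gt0 //.
have: (#|H| %| p ^ \sum_(i < r) pexpo f i)%N by rewrite -card_pgrp cardSg.
by case/(dvdn_pfactor _ _ p_prime) => k _ ->; rewrite pfactorK.
Qed.

Lemma qeval_numerator_coef (a : C) m :
  horner_morph (qeval_comm (cpow p a)) (numerator_coef m) =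
  fps_mul (sigma_series p r a) (fps_of_mpoly (Bgen r p%:R (cpow p a))) m.
Proof.
rewrite fps_mul_rmorph (eq_fps_mull _ (qeval_sigma_poly a)).
apply: eq_bigr => k _; congr (_ * _);
  rewrite /fps_of_mpoly /= -mcoeff_map_mpoly.
by rewrite Bgen_map /= rmorph_nat horner_morphX.
Qed.

(** The polynomial vanishes at every integer above [p ^ r], where the explicit formula is available.
    The conclusion no longer mentions [a], so it also covers the singular exponents. *)
Lemma numerator_coef_eq0 (m : 'X_{1..r}) (t : 'I_r) : (r - t < m t)%N ->
  numerator_coef m = 0.
Proof.
move=> ltm; apply: (@poly_nat_roots _ _ (p ^ r)) => k ltk.
have k_gt0 : (0 < k)%N by apply: leq_ltn_trans ltk.
have := qeval_numerator_coef (exp.ln k%:R / exp.ln p%:R : R)%:C m.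
rewrite (sigma_mul_B_eq0 (nonsingular_ratio ltk) ltm).
rewrite cpow_ratio ?prime_gt1 // /horner_morph -(rmorph_nat (@ratr C))
  horner_map.
by move/eqP; rewrite fmorph_eq0.
Qed.

End Rational.

(** * Lifting to polynomials with rational coefficients *)

Section Spec.
Variables (R : realType) (r : nat) (x y : R[i]).
Local Notation C := R[i].

Let spec_var (i : 'I_(2 + r)) : {mpoly C[r]} :=
  match split i with
  | inl j => (if j == ord0 then x else y)%:MP
  | inr k => 'X_k
  end.

HB.instance Definition _ := GRing.RMorphism.copy (@spec R r x y)
  (mmap (@mpolyC r C \o @ratr C) spec_var).

Definition var_x : {mpoly rat[2 + r]} := 'X_(lshift r ord0).
Definition var_y : {mpoly rat[2 + r]} := 'X_(lshift r ord_max).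
Definition var_X (t : 'I_r) : {mpoly rat[2 + r]} := 'X_(rshift 2 t).

Lemma spec_mpolyC c : spec x y (c%:MP : {mpoly rat[2 + r]}) = (ratr c)%:MP.
Proof. exact: (mmapC spec_var (@mpolyC r C \o @ratr C)). Qed.

Lemma spec_mpolyX i : spec x y ('X_i : {mpoly rat[2 + r]}) = spec_var i.
Proof. by rewrite [LHS](mmapX spec_var (@mpolyC r C \o @ratr C)) mmap1U. Qed.

Lemma spec_var_x : spec x y var_x = x%:MP.
Proof. by rewrite spec_mpolyX /spec_var (unsplitK (inl _ ord0)). Qed.

Lemma spec_var_y : spec x y var_y = y%:MP.
Proof. by rewrite spec_mpolyX /spec_var (unsplitK (inl _ ord_max)). Qed.

Lemma spec_var_X t : spec x y (var_X t) = 'X_t.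
Proof. by rewrite spec_mpolyX /spec_var (unsplitK (inr _ t)). Qed.

Lemma spec_Bgen :
  spec x y (\prod_(t < r) \prod_(j < (r - t).+1)
     (1 - var_y ^+ j * var_x ^+ ((r - t) * j - j ^ 2) * var_X t)) = Bgen r x y.
Proof.
rewrite rmorph_prod; apply: eq_bigr => t _; rewrite rmorph_prod;
  apply: eq_bigr => j _.
rewrite rmorphB rmorph1 !rmorphM !rmorphXn /= spec_var_x spec_var_y spec_var_X.
by rewrite -!rmorphXn -rmorphM mul_mpolyC.
Qed.

(** Substituting [var_y] for the indeterminate of [c] lifts one term of the numerator. *)
Lemma spec_poly_monomial (c : {poly rat}) (k : 'X_{1..r}) :
  spec x y ((map_poly (@mpolyC (2 + r) rat) c).[var_y]
            * \prod_(t < r) var_X t ^+ k t)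
  = horner_morph (qeval_comm y) c *: 'X_[k].
Proof.
rewrite rmorphM rmorph_prod mpolyXE_id -mul_mpolyC; congr (_ * _); last first.
  by apply: eq_bigr => t _; rewrite rmorphXn /= spec_var_X.
rewrite -horner_map /= spec_var_y -map_poly_comp /horner_morph -horner_map /=
  -map_poly_comp.
by congr horner; apply: eq_map_poly => z /=; rewrite spec_mpolyC.
Qed.

End Spec.

Lemma big_mdeg r d (m : 'X_{1..r}) : (r * d < mdeg m)%N ->
  exists t, (d < m t)%N.
Proof.
move=> lt; apply/existsP; apply: contraLR lt;
  rewrite negb_exists => /forallP le.
rewrite -leqNgt mdegE -[in leqRHS](card_ord r) -sum_nat_const.
by apply: leq_sum => t _; rewrite leqNgt.
Qed.

Theorem theorem1p1 (R : realType) (p r : nat) (a : R[i])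
    (p_prime : prime p) (r_ge1 : (1 <= r)%N) :
  let q := cpow p a in
  [/\ (forall (eps : {ffun 'I_r -> bool}) (t : 'I_r),
         cpow p (tail_exponent a eps t) - 1 != 0) ->
      sigma_series p r a =1 rhs_series p r a,
      in_Qratfun p%:R q (sigma_series p r a)
    & in_Qpoly p%:R q
        (fps_mul (sigma_series p r a) (fps_of_mpoly (Bpoly p r q)))].
Proof.
move=> q.
have QB : in_Qpoly p%:R q
    (fps_mul (sigma_series p r a) (fps_of_mpoly (Bpoly p r q))).
  (* A multidegree of total degree at least [d] has a component above [r], where [numerator_coef]
     vanishes; hence this finite sum is the whole product. *)
  pose d := (r * r).+1.
  exists (\sum_(k : 'X_{1..r < d})
    (map_poly (@mpolyC (2 + r) rat) (numerator_coef p k)).[var_y r]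
      * \prod_(t < r) var_X t ^+ k t) => m.
  rewrite rmorph_sum; under eq_bigr do rewrite /= spec_poly_monomial.
  rewrite -(qeval_numerator_coef p_prime a m) /fps_of_mpoly.
  have [ltmd|] := ltnP (mdeg m) d; first by rewrite
    (mcoeff_mpoly (fun m => horner_morph (qeval_comm q) (numerator_coef p m))
      ltmd).
  move=> ledm; have [t ltm] := big_mdeg ledm.
  rewrite (numerator_coef_eq0 R p_prime (t := t));
    last exact: leq_ltn_trans (leq_subr _ _) ltm.
  rewrite rmorph0 raddf_sum big1 // => k _ /=; rewrite mcoeffZ mcoeffX.
  case: eqP => [km|_]; last by rewrite mulr0.
  by have := bmdeg k; rewrite km ltnNge ledm.
split=> //; first by move=> ns m; rewrite rhs_seriesE sigma_series_rhs_sum.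
case: QB => N QN; exists N, (\prod_(t < r) \prod_(j < (r - t).+1)
     (1 - var_y r ^+ j * var_x r ^+ ((r - t) * j - j ^ 2) * var_X t)).
rewrite spec_Bgen; split=> //.
(* The specialized denominator has constant coefficient 1, so it is nonzero whatever [q] is. *)
by apply: contraNneq (oner_neq0 R[i]) => B0;
  rewrite -(Bgen_coef0 r p%:R q) B0 mcoeff0.
Qed.
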